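(* Let $\mathscr Q_n$ be a non-singular quadric in $\mathrm{PG}(n,2)$ of projective index $g\geq 1$ with point-graph $\Gamma$. Let $\alpha_s$ be an $s$-dimensional subspace contained in $\mathscr Q_n$ with $0<s<g$, and let $\Gamma_s$ be the graph constructed from $\alpha_s$ as described below. Then $\mathrm{Aut}(\Gamma_s)=(\mathrm{Aut}\,\Gamma)_{\alpha_s}$.
   Context: A non-singular quadric $\mathscr Q_n$ in $\mathrm{PG}(n,2)$ is the point set of a non-degenerate quadric; its projective index $g$ is the largest dimension of a projective subspace contained in $\mathscr Q_n$. The point-graph $\Gamma$ has vertex set the points of $\mathscr Q_n$, two distinct points adjacent iff the line joining them is contained in $\mathscr Q_n$. For an $s$-dimensional subspace $\alpha_s\subseteq\mathscr Q_n$: a point $X$ of $\mathscr Q_n$ has type (i) if $X\in\alpha_s$; type (ii) if $X\notin\alpha_s$ and $\langle\alpha_s,X\rangle\subseteq\mathscr Q_n$; type (iii) otherwise. Let $\mathcal X_s$ be the type (ii) points and $\mathcal Y_s$ the points of type (i) or (iii). The graph $\Gamma_s$ has the same vertex set as $\Gamma$ and the same edges, except that for each vertex $R\in\mathcal Y_s$ having exactly $\frac12|\mathcal X_s|$ neighbours in $\mathcal X_s$ (in $\Gamma$), those edges are deleted and $R$ is joined instead to the other $\frac12|\mathcal X_s|$ vertices of $\mathcal X_s$. Since $\Gamma$ and $\Gamma_s$ have the same vertex set, both automorphism groups are regarded as permutation groups on this set; $(\mathrm{Aut}\,\Gamma)_{\alpha_s}$ denotes the subgroup of $\mathrm{Aut}\,\Gamma$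 fixing (setwise) the set of vertices of type (i), i.e. the points of $\alpha_s$. *)

(* Defs.v *)
(* PG(n,2) is modelled on the row space 'rV['F_2]_(n.+1):
   over F_2 the projective points are exactly the nonzero vectors. *)
From HB Require Import structures.
From mathcomp Require Import all_boot all_order all_fingroup all_algebra.
Unset Strict Implicit. Unset Printing Implicit Defensive.
Import GRing.Theory.
Local Open Scope ring_scope.

Section Quadric.
Variable n : nat.
Notation vec := 'rV['F_2]_(n.+1).

(* Quadratic form Q(x) = x A x^T (every quadratic form on F_2^(n+1) is of this shape). *)
Definition qform (A : 'M['F_2]_(n.+1)) (x : vec) : 'F_2 := (x *m A *m x^T) 0 0.

Definition qpolar A (x y : vec) : 'F_2 := qform A (x + y) - qform A x - qform A y.

Definition nonsingular A : Prop :=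
  forall x : vec, qform A x = 0 -> (forall y, qpolar A x y = 0) -> x = 0.

Definition tsing A m (U : 'M['F_2]_(m, n.+1)) : bool :=
  [forall v : vec, (v <= U)%MS ==> (qform A v == 0)].

Definition proj_index A (g : nat) : Prop :=
  (exists U : 'M['F_2]_(n.+1), tsing A _ U /\ \rank U = g.+1) /\
  (forall U : 'M['F_2]_(n.+1), tsing A _ U -> (\rank U <= g.+1)%N).

Definition qpointb A (x : vec) : bool := (x != 0) && (qform A x == 0).
Definition qpt A := {x : vec | qpointb A x}.

Definition adjGb A (x y : qpt A) : bool :=
  (x != y) && tsing A _ (col_mx (val x) (val y)).

Definition in_alpha A (U : 'M['F_2]_(n.+1)) (x : qpt A) : bool := (val x <= U)%MS.

Definition typeII A (U : 'M['F_2]_(n.+1)) (x : qpt A) : bool :=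
  ~~ in_alpha A U x && tsing A _ (col_mx U (val x)).
Definition Xs A U : {set qpt A} := [set x | typeII A U x].

Definition switched A U (r : qpt A) : bool :=
  (r \notin Xs A U) && (#|[set p in Xs A U | adjGb A r p]|.*2 == #|Xs A U|)%N.

Definition adjGs A U (x y : qpt A) : bool :=
  if (x \in Xs A U) == (y \in Xs A U) then adjGb A x y
  else if x \in Xs A U then (if switched A U y then ~~ adjGb A y x else adjGb A y x)
  else (if switched A U x then ~~ adjGb A x y else adjGb A x y).

Definition GAut (T : finType) (e : rel T) : {set {perm T}} :=
  [set s : {perm T} | [forall x, forall y, e (s x) (s y) == e x y]].

End Quadric.

(* Main.v *)
(* Write B for the polar form and alpha for the subspace U.  Call {a, b, c} odd in a
   graph when every vertex equals or is adjacent to an odd number of a, b, c; in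
   Gamma every line of the quadric is odd.  Switching does not destroy the oddness
   of the lines meeting alpha, so a point of alpha lies in an odd triple with each
   of its Gamma_s-neighbours.  A point x outside alpha has a Gamma_s-neighbour y for
   which {x, y, c} is never odd: for x of type (ii) take y of type (iii) with
   B(x, y) = 1, for x of type (iii) take y such that the line xy consists of
   type (iii) points.  Hence Aut(Gamma_s) preserves alpha, therefore all types,
   therefore Gamma. *)
Require Import Defs.
From HB Require Import structures.
From mathcomp Require Import all_boot all_order all_fingroup all_algebra.
Set Implicit Arguments. Unset Strict Implicit. Unset Printing Implicit Defensive.
Import GRing.Theory.
Local Open Scope ring_scope.

(** * Arithmetic in F_2 and re-indexing by permutations *)

Lemma F2_cases (a : 'F_2) : a = 0 \/ a = 1.
Proof. by case: a => [[|[|k]] // lt_k]; [left | right]; apply: val_inj. Qed.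

Lemma F2_neq0D (a b : 'F_2) : (a + b != 0) = (a != 0) (+) (b != 0).
Proof. by case: (F2_cases a) => ->; case: (F2_cases b) => ->. Qed.

Lemma forall_perm (T : finType) (f : {perm T}) (P : pred T) :
  [forall x, P x] = [forall x, P (f x)].
Proof.
apply/forallP/forallP => H x; first exact: H.
by rewrite -(permKV f x).
Qed.

Lemma exists_perm (T : finType) (f : {perm T}) (P : pred T) :
  [exists x, P x] = [exists x, P (f x)].
Proof. by apply: negb_inj; rewrite !negb_exists (forall_perm f). Qed.

Lemma GAutP (T : finType) (e : rel T) (f : {perm T}) :
  reflect (forall x y, e (f x) (f y) = e x y) (f \in GAut T e).
Proof. by rewrite inE; apply: (iffP 'forall_'forall_eqP). Qed.

Lemma imset_permP (T : finType) (P : pred T) (f : {perm T}) :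
  reflect (forall x, P (f x) = P x) (f @: [set x | P x] == [set x | P x]).
Proof.
apply: (iffP eqP) => [E x | H].
  by have := mem_imset [set x | P x] x (@perm_inj _ f); rewrite E !inE.
apply/setP => x; rewrite -(permKV f x) mem_imset ?inE ?H //; exact: perm_inj.
Qed.

(** * The quadratic form and its polar form over F_2 *)

Section QuadraticForm.
Variables (n : nat) (A : 'M['F_2]_(n.+1)).
Local Notation vec := 'rV['F_2]_(n.+1).
Implicit Types x y z u v : vec.

Lemma vec_addxx x : x + x = 0.
Proof. by apply/rowP => i; rewrite !mxE; case: (F2_cases (x 0 i)) => ->; apply: val_inj. Qed.

Lemma vec_addKx x y : x + (x + y) = y.
Proof. by rewrite addrA vec_addxx add0r. Qed.

Lemma mx11D (M N : 'M['F_2]_1) : (M + N) 0 0 = M 0 0 + N 0 0.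
Proof. by rewrite mxE. Qed.

Lemma qpolarE x y : qpolar n A x y = (x *m (A + A^T) *m y^T) 0 0.
Proof.
have Asym : (y *m A *m x^T) 0 0 = (x *m A^T *m y^T) 0 0.
  transitivity ((y *m A *m x^T)^T 0 0); first by rewrite [RHS]mxE.
  by rewrite !trmx_mul trmxK mulmxA.
rewrite /qpolar /qform linearD /= mulmxDr !mulmxDl mulmxDr !mulmxDl.
rewrite !mx11D Asym.
set a := _ 0 0; set b := _ 0 0; set c := _ 0 0; set d := _ 0 0.
by case: (F2_cases a) (F2_cases b) (F2_cases c) (F2_cases d)
  => -> [->|->] [->|->] [->|->]; apply: val_inj.
Qed.

(** Boolean-valued, so that additivity becomes exclusive or and identities close by case
    analysis. *)
Definition polar x y : bool := qpolar n A x y != 0.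

Lemma polarC x y : polar x y = polar y x.
Proof. by rewrite /polar /qpolar [y + x]addrC addrAC. Qed.

Lemma polarDl x y z : polar (x + y) z = polar x z (+) polar y z.
Proof. by rewrite /polar -F2_neq0D !qpolarE -mx11D -!mulmxDl. Qed.

Lemma polarDr x y z : polar z (x + y) = polar z x (+) polar z y.
Proof. by rewrite polarC polarDl !(polarC z). Qed.

Lemma polarxx x : polar x x = false.
Proof.
apply/negbTE; rewrite negbK /qpolar vec_addxx [qform n A 0]/qform !mul0mx mxE.
by case: (F2_cases (qform n A x)) => ->.
Qed.

Lemma qform_addE x y :
  (qform n A (x + y) == 0) = ~~ (polar x y (+) (qform n A x != 0) (+) (qform n A y != 0)).
Proof.
rewrite /polar /qpolar.
by case: (F2_cases (qform n A (x + y))) (F2_cases (qform n A x)) (F2_cases (qform n A y))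
  => -> [->|->] [->|->].
Qed.

Lemma tsingP m (M : 'M_(m, n.+1)) :
  reflect (forall v, (v <= M)%MS -> qform n A v = 0) (tsing n A m M).
Proof.
apply: (iffP forallP) => H v; first by move/(implyP (H v))/eqP.
by apply/implyP => /H->.
Qed.

Lemma tsing_polar m (M : 'M_(m, n.+1)) u v :
  tsing n A m M -> (u <= M)%MS -> (v <= M)%MS -> polar u v = false.
Proof.
move=> /tsingP MS uM vM; apply/negbTE; rewrite negbK /qpolar.
by rewrite !MS ?addmx_sub //; apply/eqP; apply: val_inj.
Qed.

Lemma F2_subrow x v : reflect (v = 0 \/ v = x) (v <= x)%MS.
Proof.
apply: (iffP sub_rVP) => [[a ->]|[->|->]].
- by case: (F2_cases a) => ->; rewrite ?scale0r ?scale1r; [left | right].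
- by exists 0; rewrite scale0r.
- by exists 1; rewrite scale1r.
Qed.

(** Q(u + x) = Q(u) + Q(x) + B(u, x), and for u in [M] only the last term can be nonzero. *)
Lemma tsing_col m (M : 'M_(m, n.+1)) x :
  tsing n A m M -> qform n A x = 0 ->
  tsing n A _ (col_mx M x) = [forall u : vec, (u <= M)%MS ==> ~~ polar u x].
Proof.
move=> MS Qx; apply/idP/forallP => [/tsing_polar H u | H].
  apply/implyP => uM; rewrite H //.
    by rewrite -addsmxE (submx_trans uM) ?addsmxSl.
  by rewrite -addsmxE addsmxSr.
apply/tsingP => v; rewrite -addsmxE => /sub_addsmxP[[a b] /= ->].
have /F2_subrow[-> | ->] := submxMl b x.
  by rewrite addr0; apply: (tsingP _ MS); rewrite submxMl.
apply/eqP; rewrite qform_addE (tsingP _ MS) ?submxMl // Qx eqxx !addbF.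
exact: implyP (H _) (submxMl _ _).
Qed.

Lemma tsing_row x : qform n A x = 0 -> tsing n A 1 x.
Proof.
move=> Qx; apply/tsingP => v /F2_subrow[] -> //.
by rewrite /qform !mul0mx mxE.
Qed.

Lemma polar0l x : polar 0 x = false.
Proof. by rewrite -(vec_addxx x) polarDl addbb. Qed.

Lemma adjGbE (x y : qpt n A) : adjGb n A x y = (x != y) && ~~ polar (val x) (val y).
Proof.
have Q (z : qpt n A) : qform n A (val z) = 0 by case/andP: (valP z) => _ /eqP.
rewrite /adjGb tsing_col ?tsing_row //; congr (_ && _).
apply/forallP/idP => [/(_ (val x)) /implyP-> // | Bxy u].
by apply/implyP => /F2_subrow[]->; rewrite ?polar0l.
Qed.

(** Writing the perp of a row space as a kernel makes rank formulas available in [exists_typeII]. *)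
Lemma polar_kermx m (M : 'M_(m, n.+1)) v :
  reflect (forall u, (u <= M)%MS -> polar v u = false)
          (v <= kermx ((A + A^T) *m M^T))%MS.
Proof.
apply: (iffP sub_kermxP) => [H u /submxP[w ->] | H].
  by rewrite /polar qpolarE trmx_mul mulmxA -[v *m _ *m _]mulmxA H mul0mx mxE eqxx.
apply/rowP => i; have := H _ (row_sub i M).
move/negbFE/eqP; rewrite qpolarE tr_row !mulmxA => H0.
rewrite [RHS]mxE -H0 !mxE; apply: eq_bigr => k _; by rewrite !mxE.
Qed.

Lemma qpt_qform (x : qpt n A) : qform n A (val x) = 0.
Proof. by case/andP: (valP x) => _ /eqP. Qed.

Lemma qpt_neq0 (x : qpt n A) : val x != 0.
Proof. by case/andP: (valP x). Qed.

Lemma qpt_of v : v != 0 -> qform n A v = 0 -> exists x : qpt n A, val x = v.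
Proof. by move=> v0 Qv; have Pv : qpointb n A v; [rewrite /qpointb v0 Qv | exists (Sub v Pv)]. Qed.

Lemma qpt_add (x y : qpt n A) :
  x != y -> ~~ polar (val x) (val y) -> exists z : qpt n A, val z = val x + val y.
Proof.
move=> neq_xy Bxy; apply: qpt_of.
  by apply: contraNneq neq_xy => xy0; rewrite -val_eqE -[val y](vec_addKx (val x)) xy0 addr0.
by apply/eqP; rewrite qform_addE !qpt_qform eqxx !addbF.
Qed.

(** * Prescribing polar values by non-singularity *)

Hypothesis nsA : nonsingular n A.

Lemma nonsingular_polar v : v != 0 -> qform n A v = 0 -> exists y, polar y v.
Proof.
move=> v0 Qv; apply/existsP; apply: contraNT v0 => /existsPn B0.
apply/eqP/nsA => // y; apply/eqP; have := B0 y.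
by rewrite polarC negbK.
Qed.

(** B(-, a), B(-, b) and their sum are nonzero, as [y1], [y2], [y3] witness, so the two functionals
    are independent. *)
Lemma exists_polar2 a b (c : bool) :
  a != 0 -> b != 0 -> a != b -> qform n A a = 0 -> qform n A b = 0 ->
  ~~ polar a b -> exists y, polar y a /\ polar y b = c.
Proof.
move=> a0 b0 neq_ab Qa Qb Bab.
have ab0 : a + b != 0.
  by apply: contraNneq neq_ab => ab0; rewrite -[b](vec_addKx a) ab0 addr0.
have Qab : qform n A (a + b) = 0.
  by apply/eqP; rewrite qform_addE Qa Qb eqxx !addbF.
have [y1 B1] := nonsingular_polar a0 Qa; have [y2 B2] := nonsingular_polar b0 Qb.
have [y3] := nonsingular_polar ab0 Qab; rewrite polarDr => B3.
have [E|] := eqVneq (polar y1 b) c; first by exists y1.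
case E2: (polar y2 a) B3.
  have [|] := eqVneq (polar y2 b) c; first by exists y2.
  case E3: (polar y3 a); case E4: (polar y3 b); case E1: (polar y1 b) => //=; rewrite B2.
  1-2: by case: c => // _ _ _; exists y3.
  1-2: by case: c => // _ _ _; exists (y1 + y3); rewrite !polarDl B1 E1 E3 E4.
move=> _ neq; exists (y1 + y2); rewrite !polarDl B1 E2 B2; split=> //.
by case: (polar y1 b) c neq => [] [].
Qed.

Lemma exists_qpt_polar2 a b (c : bool) :
  a != 0 -> b != 0 -> a != b -> qform n A a = 0 -> qform n A b = 0 ->
  ~~ polar a b -> exists y : qpt n A, polar (val y) a /\ polar (val y) b = c.
Proof.
move=> a0 b0 neq_ab Qa Qb Bab.
have [y [Bya Byb]] := exists_polar2 c a0 b0 neq_ab Qa Qb Bab.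
have pt z : polar z a -> polar z b = c -> qform n A z = 0 ->
  exists y : qpt n A, polar (val y) a /\ polar (val y) b = c.
  move=> Bza Bzb Qz; have [|w Ew] := qpt_of _ Qz; last by exists w; rewrite Ew.
  by apply: contraTneq Bza => ->; rewrite polar0l.
have [|Qy] := eqVneq (qform n A y) 0; first exact: pt.
(* Q(y + a) = Q(y) + Q(a) + B(y, a) = 1 + 0 + 1 = 0, and adding [a] changes neither polar value. *)
apply: (pt (y + a)); rewrite ?polarDl ?polarxx ?Bya ?(negbTE Bab) ?addbF //.
by apply/eqP; rewrite qform_addE Bya Qy Qa eqxx.
Qed.

(** * Types of points and the switched vertices *)

Section Switching.
Variables (g s : nat) (U : 'M['F_2]_(n.+1)).
Hypotheses (idxA : proj_index n A g) (tsU : tsing n A _ U) (rkU : \rank U = s.+1).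
Hypotheses (s_gt0 : (0 < s)%N) (lt_sg : (s < g)%N).
Implicit Types p q r : qpt n A.

Local Notation inU := (in_alpha n A U).
Local Notation X := (Xs n A U).

(** A quadric point spans a singular subspace with alpha exactly when it is perpendicular to alpha,
    as every point of alpha is. *)
Definition typeIII p : bool := [exists u : vec, (u <= U)%MS && polar u (val p)].

Lemma typeIIE p : (p \in X) = ~~ inU p && ~~ typeIII p.
Proof.
rewrite inE /typeII tsing_col ?qpt_qform // negb_exists; congr (_ && _).
by apply: eq_forallb => u; rewrite negb_and implybE.
Qed.

Lemma typeIII_polar p u : (u <= U)%MS -> polar (val p) u -> typeIII p.
Proof. by move=> uU Bpu; apply/existsP; exists u; rewrite uU polarC. Qed.

Lemma inU_typeIII p : inU p -> typeIII p = false.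
Proof.
by move=> pU; apply/existsP => -[u /andP[uU]]; rewrite (tsing_polar tsU).
Qed.

Lemma typeIII_notII p : typeIII p -> (p \in X) = false.
Proof. by move=> p3; rewrite typeIIE p3 andbF. Qed.

Lemma notIII_polar p u : ~~ typeIII p -> (u <= U)%MS -> polar (val p) u = false.
Proof. by move=> p3 uU; apply: contraNF p3; apply: typeIII_polar. Qed.

Lemma inU_add p q u : (u <= U)%MS -> val q = u + val p -> inU q = inU p.
Proof.
rewrite /in_alpha => uU ->; apply/idP/idP => [H | pU]; last exact: addmx_sub.
by rewrite -[val p](vec_addKx u) addmx_sub.
Qed.

(** [U] is perpendicular to itself, so translating by [u] keeps all values of B against [U]. *)
Lemma typeIII_add p q u : (u <= U)%MS -> val q = u + val p -> typeIII q = typeIII p.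
Proof.
move=> uU Eq; apply: eq_existsb => v; apply: andb_id2l => vU.
by rewrite Eq polarDr (tsing_polar tsU).
Qed.

Lemma typeII_add p q u : (u <= U)%MS -> val q = u + val p -> (q \in X) = (p \in X).
Proof. by move=> uU Eq; rewrite !typeIIE (inU_add uU Eq) (typeIII_add uU Eq). Qed.

Lemma exists_typeII : exists p, p \in X.
Proof.
have [[M [tsM rkM]] _] := idxA.
set B := A + A^T; have Bsym : B^T = B by rewrite linearD /= trmxK addrC.
(* [W] is the part of a maximal singular [M] perpendicular to [U]; a row of it outside [U] is a type
   (ii) point. *)
pose W := (M :&: kermx (B *m U^T))%MS.
have [WU | /row_subPn[i nU]] := boolP (W <= U)%MS; last first.
  have /andP[vM vK] : (row i W <= M)%MS && (row i W <= kermx (B *m U^T))%MS.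
    by rewrite -sub_capmx row_sub.
  have v0 : row i W != 0 by apply: contraNneq nU => ->; rewrite sub0mx.
  have [p Ep] := qpt_of v0 (tsingP _ tsM _ vM).
  exists p; rewrite typeIIE /in_alpha Ep nU /=.
  apply/existsP => -[u /andP[uU]]; rewrite Ep polarC.
  by rewrite (polar_kermx _ _ vK).
(* Otherwise [W] lies in [U] and in the perp of [M]. The pairing of [M] with [U] has the rank of its
   transpose, so rank-nullity on both sides yields g + 1 <= s + 1. *)
have := mxrank_mul_ker M (B *m U^T); rewrite -/W rkM.
have := mxrank_mul_ker U (B *m M^T); rewrite rkU.
have -> : \rank (U *m (B *m M^T)) = \rank (M *m (B *m U^T)).
  by rewrite -mxrank_tr !trmx_mul trmxK Bsym mulmxA.
have leW : (\rank W <= \rank (U :&: kermx (B *m M^T)))%N.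
  apply: mxrankS; rewrite sub_capmx WU /=; apply/row_subP => i; apply/polar_kermx => u uM.
  by apply: (tsing_polar tsM) => //; apply: submx_trans (row_sub _ _) (capmxSl _ _).
move=> Es Eg; suff: (g.+1 <= s.+1)%N by rewrite leqNgt ltnS lt_sg.
by rewrite -Es -Eg leq_add2l.
Qed.

Lemma card_typeII_gt0 : (0 < #|X|)%N.
Proof. by have [p Xp] := exists_typeII; apply/card_gt0P; exists p. Qed.

(* Translation by a point [u] of [alpha] not perpendicular to [r] permutes the
   type (ii) points and exchanges neighbours and non-neighbours of [r]. *)
Lemma switchedE r : r \notin X -> switched n A U r = typeIII r.
Proof.
move=> rX; rewrite /switched rX /=; have [r3 | r3] := boolP (typeIII r); last first.
  have rU : inU r by move: rX; rewrite typeIIE r3 andbT negbK.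
  (* A point of alpha is adjacent to all of [X], which is nonempty, so the count is not one half. *)
  have -> : [set p in X | adjGb n A r p] = X.
    apply/setP => p; rewrite inE; apply: andb_idr => Xp.
    rewrite adjGbE; apply/andP; split; first by apply: contraNneq rX => ->.
    by move: Xp; rewrite typeIIE polarC => /andP[_ p3]; rewrite notIII_polar.
  by apply/negbTE; rewrite -addnn -[X in _ != X]addn0 eqn_add2l -lt0n card_typeII_gt0.
have /existsP[u /andP[uU Bur]] := r3.
have [tr trE] : exists tr : qpt n A -> qpt n A,
    forall p, p \in X -> val (tr p) = u + val p.
  (* The default [p] of [insubd] is never reached on [X], where u + p is a quadric point. *)
  exists (fun p => insubd p (u + val p)) => p Xp; rewrite val_insubd.
  move: (Xp); rewrite typeIIE => /andP[pU p3].
  rewrite ifT //; apply/andP; split.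
    apply: contraNneq pU => E; rewrite /in_alpha -[val p](vec_addKx u).
    by rewrite E addr0.
  by rewrite qform_addE polarC notIII_polar // qpt_qform (tsingP _ tsU) ?eqxx.
have trX p : p \in X -> tr p \in X by move=> Xp; rewrite (typeII_add uU (trE _ Xp)).
have tr_inj : {in X &, injective tr}.
  move=> p q Xp Xq /(congr1 val); rewrite !trE // => E.
  by apply: val_inj; rewrite -[LHS](vec_addKx u) E vec_addKx.
have adjE p : p \in X -> adjGb n A r p = ~~ polar (val r) (val p).
  move=> Xp; rewrite adjGbE; case: eqP => // rp.
  by rewrite rp Xp in rX.
have adjtr p : p \in X -> adjGb n A r (tr p) = ~~ adjGb n A r p.
  by move=> Xp; rewrite !adjE ?trX // trE // polarDr polarC Bur.
pose S := [set p in X | adjGb n A r p]; pose S' := [set p in X | ~~ adjGb n A r p].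
have SX : {subset S <= X} by move=> p; rewrite inE => /andP[].
have S'X : {subset S' <= X} by move=> p; rewrite inE => /andP[].
have eqS : #|S| = #|S'|.
  apply/eqP; rewrite eqn_leq; apply/andP; split.
    rewrite -(card_in_imset (sub_in2 SX tr_inj)); apply: subset_leq_card.
    apply/subsetP => _ /imsetP[p Sp ->]; rewrite inE trX ?SX // adjtr ?SX // negbK.
    by move: Sp; rewrite inE => /andP[].
  rewrite -(card_in_imset (sub_in2 S'X tr_inj)); apply: subset_leq_card.
  apply/subsetP => _ /imsetP[p Sp ->]; rewrite inE trX ?S'X // adjtr ?S'X //.
  by move: Sp; rewrite inE => /andP[].
have -> : #|X| = (#|S| + #|S'|)%N.
  rewrite -(cardsID [set p | adjGb n A r p] X); congr (_ + _)%N; apply: eq_card => p.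
    by rewrite !inE.
  by rewrite !inE andbC.
by rewrite -eqS addnn eqxx.
Qed.

(** * Adjacency in Gamma_s *)

Definition exchanged p q := (p \in X) && typeIII q || typeIII p && (q \in X).

Lemma adjGbC p q : adjGb n A p q = adjGb n A q p.
Proof. by rewrite !adjGbE eq_sym polarC. Qed.

(** By [switchedE] the switched vertices are those of type (iii), so adjacency is reversed exactly
    between types (ii) and (iii). *)
Lemma adjGsE p q : adjGs n A U p q = adjGb n A p q (+) exchanged p q.
Proof.
rewrite /adjGs /exchanged.
have [Xp | Xp] := boolP (p \in X); have [Xq | Xq] := boolP (q \in X) => /=.
- by move: Xp Xq; rewrite !typeIIE => /andP[_ /negbTE->] /andP[_ /negbTE->]; rewrite addbF.
- by rewrite switchedE // adjGbC andbF orbF; case: typeIII; rewrite ?addbT ?addbF.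
- by rewrite switchedE // andbT; case: typeIII; rewrite ?addbT ?addbF.
- by rewrite andbF addbF.
Qed.

Lemma adjGs_inU p q : inU p -> adjGs n A U p q = adjGb n A p q.
Proof.
by move=> pU; rewrite adjGsE /exchanged (inU_typeIII pU) [p \in X]typeIIE pU addbF.
Qed.

(** Including the diagonal absorbs the condition that p and q differ, so [nearE] is a purely
    additive formula. *)
Definition near p q := (p == q) || adjGs n A U p q.

Lemma exchangedxx p : exchanged p p = false.
Proof. by rewrite /exchanged typeIIE; case: typeIII; rewrite ?andbF. Qed.

Lemma nearE p q : near p q = ~~ (polar (val p) (val q) (+) exchanged p q).
Proof.
rewrite /near adjGsE adjGbE; case: eqP => [-> | _] /=.
  by rewrite polarxx exchangedxx.
by case: polar; case: exchanged.
Qed.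

(** * Odd triples and the recognition of alpha *)

Definition odd_triple p q r := [forall z, near z p (+) near z q (+) near z r].

(** Phrased in Gamma_s alone, hence invariant under its automorphisms; [collapsibleE] shows that it
    singles out alpha. *)
Definition collapsible p :=
  [forall q, adjGs n A U p q ==> [exists r, odd_triple p q r]].

(** The third vertex is p + q. It has the type of q, so their exchange terms cancel, and p has
    none. *)
Lemma inU_collapsible p : inU p -> collapsible p.
Proof.
move=> pU; apply/forallP => q; apply/implyP; rewrite adjGs_inU // adjGbE.
case/andP=> npq Bpq; have [r Er] := qpt_add npq Bpq.
apply/existsP; exists r; apply/forallP => z; rewrite !nearE Er polarDr.
rewrite /exchanged (typeII_add pU Er) (typeIII_add pU Er) (inU_typeIII pU) [p \in X]typeIIE pU !andbF.
by case: (polar _ (val p)); case: (polar _ (val q)); case: (_ && _ || _).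
Qed.

Lemma exists_inU_pair : exists a b : vec,
  [/\ (a <= U)%MS, (b <= U)%MS, a != 0, b != 0 & a != b].
Proof.
have [a /andP[aU a0]] : exists a : vec, (a <= U)%MS && (a != 0).
  have : (0 < \rank U)%N by rewrite rkU.
  rewrite lt0n mxrank_eq0 => /rowV0Pn[a aU a0]; by exists a; rewrite aU.
(* Since s > 0, [U] has rank at least 2 and is not spanned by one vector. *)
have /row_subPn[i ni] : ~~ (U <= a)%MS.
  apply/negP => /mxrankS; rewrite rkU => /leq_trans/(_ (rank_leq_row _)).
  by rewrite ltnNge s_gt0.
exists a, (row i U); split=> //; first exact: row_sub.
  by apply: contraNneq ni => ->; rewrite sub0mx.
by apply: contraNneq ni => <-.
Qed.

(** B(-, v) is additive, so on a line of alpha it vanishes at one of the three points. *)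
Lemma exists_inU_perp v : exists b : vec, [/\ (b <= U)%MS, b != 0 & ~~ polar b v].
Proof.
have [a [b [aU bU a0 b0 nab]]] := exists_inU_pair.
have [Ba | Ba] := boolP (polar a v); last by exists a.
have [Bb | Bb] := boolP (polar b v); last by exists b.
exists (a + b); rewrite addmx_sub ?polarDl ?Ba ?Bb //; split=> //.
by apply: contraNneq nab => ab0; rewrite -[b](vec_addKx a) ab0 addr0.
Qed.

Lemma qform_inU u : (u <= U)%MS -> qform n A u = 0.
Proof. exact: tsingP tsU u. Qed.

Lemma exists_typeIII : exists p, typeIII p.
Proof.
have [a [b [aU bU a0 b0 nab]]] := exists_inU_pair.
have [|y [Bya _]] := exists_qpt_polar2 true a0 b0 nab (qform_inU aU) (qform_inU bU).
  by rewrite (tsing_polar tsU).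
by exists y; apply: typeIII_polar Bya.
Qed.

(** Take b in alpha perpendicular to p, and q perpendicular to p but not to b; then p + q is not
    perpendicular to b either. *)
Lemma typeIII_line p : typeIII p -> exists q r,
  [/\ p != q, ~~ polar (val p) (val q), val r = val p + val q, typeIII q & typeIII r].
Proof.
move=> p3; have [b [bU b0 Bbp]] := exists_inU_perp (val p).
have nbp : b != val p.
  by apply: contraTneq p3 => Eb; rewrite inU_typeIII // /in_alpha -Eb.
have [q [Bqb Bqp]] :=
  exists_qpt_polar2 false b0 (qpt_neq0 p) nbp (qform_inU bU) (qpt_qform p) Bbp.
have npq : p != q by apply: contraTneq Bqb => <-; rewrite polarC.
have Bpq : ~~ polar (val p) (val q) by rewrite polarC Bqp.
have [r Er] := qpt_add npq Bpq.
exists q, r; split=> //; first exact: typeIII_polar Bqb.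
by apply: (typeIII_polar bU); rewrite Er polarDl Bqb [polar _ b]polarC (negbTE Bbp).
Qed.

(** A point a of alpha is perpendicular to p, so B(q, a) = 1 and B(q, p) = c can be prescribed
    together. *)
Lemma typeII_typeIII_polar p c : p \in X -> exists2 q, typeIII q & polar (val q) (val p) = c.
Proof.
rewrite typeIIE => /andP[pU p3]; have [a [_ [aU _ a0 _ _]]] := exists_inU_pair.
have nap : a != val p by apply: contraNneq pU; rewrite /in_alpha => <-.
have Bap : ~~ polar a (val p) by rewrite polarC notIII_polar.
have [q [Bqa Bqp]] :=
  exists_qpt_polar2 c a0 (qpt_neq0 p) nap (qform_inU aU) (qpt_qform p) Bap.
by exists q => //; apply: typeIII_polar Bqa.
Qed.

(** The three negations from [nearE] merge into one, turning oddness into a linear condition on p +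
    q + r. *)
Lemma odd_tripleE p q r (z : qpt n A) : odd_triple p q r ->
  polar (val z) (val p + val q + val r) =
  exchanged z p (+) exchanged z q (+) exchanged z r.
Proof.
move/forallP/(_ z); rewrite !nearE !polarDr.
by do 3!case: polar; do 3!case: exchanged.
Qed.

(* Testing oddness against the points of [alpha] puts [p + q + r] in its perp. *)
Lemma odd_triple_perp p q r u : odd_triple p q r -> (u <= U)%MS ->
  ~~ polar u (val p + val q + val r).
Proof.
move=> odd uU; have [-> | u0] := eqVneq u 0; first by rewrite polar0l.
have [z Ez] := qpt_of u0 (qform_inU uU).
have zU : inU z by rewrite /in_alpha Ez.
by rewrite -Ez odd_tripleE // /exchanged (inU_typeIII zU) [z \in X]typeIIE zU.
Qed.

Lemma typeII_not_collapsible p : p \in X -> ~~ collapsible p.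
Proof.
move=> Xp; have [q q3 Bqp] := typeII_typeIII_polar true Xp.
have p3 : typeIII p = false by move: Xp; rewrite typeIIE => /andP[_ /negbTE].
apply/forallPn; exists q; rewrite negb_imply adjGsE adjGbE polarC Bqp andbF.
rewrite /exchanged Xp q3 /=; apply/existsPn => r; apply/negP => odd.
have r3 : typeIII r.
  have /existsP[u /andP[uU Buq]] := q3; apply: (typeIII_polar uU).
  have := odd_triple_perp odd uU; rewrite !polarDr Buq polarC notIII_polar ?p3 //.
  by rewrite polarC; case: polar.
(* Among p, q, r only p is exchanged with a type (iii) point z. *)
have w1 (z : qpt n A) : typeIII z -> polar (val z) (val p + val q + val r).
  move=> z3; rewrite odd_tripleE // /exchanged Xp q3 r3 z3 p3.
  by rewrite !(typeIII_notII z3) !(typeIII_notII q3) !(typeIII_notII r3).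
(* On a line of type (iii) points the three values of B against p + q + r would all be 1, yet they
   sum to 0. *)
have [z z3] := exists_typeIII; have [z1 [z2 [_ _ E z13 z23]]] := typeIII_line z3.
by have := w1 _ z23; rewrite E polarDl !w1.
Qed.

Lemma typeIII_not_collapsible p : typeIII p -> ~~ collapsible p.
Proof.
move=> p3; have [q [t [npq Bpq Et q3 t3]]] := typeIII_line p3.
have nX := typeIII_notII.
apply/forallPn; exists q; rewrite negb_imply adjGsE adjGbE npq Bpq.
rewrite /exchanged !nX // andbF /=; apply/existsPn => r; apply/negP => odd.
have r3 : typeIII r.
  have /existsP[u /andP[uU But]] := t3; apply: (typeIII_polar uU).
  have := odd_triple_perp odd uU; rewrite polarDr -Et But.
  by rewrite polarC; case: polar.
(* On the line z, x, y = z + x, with x of type (ii) and z, y of type (iii), B against p + q + r is 0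
   at z and y but 1 at x, where all three vertices are exchanged. *)
have [x Xx] := exists_typeII; have [z z3 Bzx] := typeII_typeIII_polar false Xx.
have nzx : z != x by apply: contraTneq z3 => ->; move: Xx; rewrite typeIIE => /andP[].
have [y Ey] := qpt_add nzx (negbT Bzx).
have y3 : typeIII y.
  have /existsP[u /andP[uU Buz]] := z3; apply: (typeIII_polar uU).
  rewrite Ey polarDl [polar (val z) u]polarC Buz notIII_polar //.
  by move: Xx; rewrite typeIIE => /andP[].
have w0 (v : qpt n A) : typeIII v -> polar (val v) (val p + val q + val r) = false.
  by move=> v3; rewrite odd_tripleE // /exchanged !nX // !andbF.
have := w0 _ y3; rewrite Ey polarDl w0 // odd_tripleE // /exchanged.
by rewrite Xx p3 q3 r3.
Qed.

(** * Recovering the types and comparing the automorphism groups *)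

Lemma collapsibleE p : collapsible p = inU p.
Proof.
apply/idP/idP; last exact: inU_collapsible.
apply: contraTT => pU; have [p3 | p3] := boolP (typeIII p).
  exact: typeIII_not_collapsible.
by apply: typeII_not_collapsible; rewrite typeIIE pU.
Qed.

(** Only edges at points of alpha occur here, and these agree in Gamma and Gamma_s. *)
Lemma typeII_adj p :
  (p \in X) = ~~ inU p && [forall q, inU q ==> adjGb n A q p].
Proof.
rewrite typeIIE; apply: andb_id2l => pU; apply/idP/forallP => [p3 q | H].
  apply/implyP => qU; rewrite adjGbE polarC notIII_polar // andbT.
  by apply: contraNneq pU => <-.
apply/existsP => -[u /andP[uU Bup]].
have u0 : u != 0 by apply: contraTneq Bup => ->; rewrite polar0l.
have [q Eq] := qpt_of u0 (qform_inU uU).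
by have := H q; rewrite /in_alpha adjGbE Eq uU Bup andbF.
Qed.

Lemma collapsible_GAut (f : {perm qpt n A}) p :
  (forall p q, adjGs n A U (f p) (f q) = adjGs n A U p q) ->
  collapsible (f p) = collapsible p.
Proof.
move=> Hf; have Hnear (x y : qpt n A) : near (f x) (f y) = near x y.
  by rewrite /near Hf (inj_eq perm_inj).
rewrite /collapsible (forall_perm f); apply: eq_forallb => q; rewrite Hf; congr (_ ==> _).
rewrite (exists_perm f); apply: eq_existsb => r.
by rewrite /odd_triple (forall_perm f); apply: eq_forallb => z; rewrite !Hnear.
Qed.

(** Asking for adjacency only at points of alpha lets this serve both inclusions of
    [GAut_switched]. *)
Lemma exchanged_perm (f : {perm qpt n A}) p q :
  (forall p, inU (f p) = inU p) ->
  (forall p q, inU p -> adjGb n A (f p) (f q) = adjGb n A p q) ->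
  exchanged (f p) (f q) = exchanged p q.
Proof.
move=> fU fadj; have fX (x : qpt n A) : (f x \in X) = (x \in X).
  rewrite !typeII_adj fU (forall_perm f); congr (_ && _); apply: eq_forallb => y.
  by rewrite fU; case: (boolP (inU y)) => //= yU; apply: fadj.
have E3 (x : qpt n A) : typeIII x = ~~ inU x && (x \notin X).
  rewrite typeIIE; case: (boolP (inU x)) => [/inU_typeIII // | _] /=.
  by rewrite negbK.
by rewrite /exchanged !E3 !fX !fU.
Qed.

Lemma GAut_switched :
  GAut _ (adjGs n A U) =
  [set f in GAut _ (adjGb n A) | f @: [set p | inU p] == [set p | inU p]].
Proof.
apply/setP => f; rewrite [RHS]inE; apply/GAutP/andP => [Hf | [/GAutP Hf /imset_permP fU] p q].
  have fU p : inU (f p) = inU p by rewrite -!collapsibleE collapsible_GAut.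
  have fadj p q : inU p -> adjGb n A (f p) (f q) = adjGb n A p q.
    by move=> pU; rewrite -!adjGs_inU ?fU.
  split; last exact/imset_permP.
  (* The exchange term is invariant under [f], so it cancels from both sides. *)
  apply/GAutP => p q; have := Hf p q; rewrite !adjGsE exchanged_perm //.
  exact: addIb.
by rewrite !adjGsE Hf exchanged_perm.
Qed.

End Switching.
End QuadraticForm.

Theorem theorem7p1 (n : nat) (A : 'M['F_2]_(n.+1)) (g s : nat)
  (U : 'M['F_2]_(n.+1)) :
  nonsingular n A -> proj_index n A g -> (1 <= g)%N ->
  tsing n A _ U -> \rank U = s.+1 -> (0 < s)%N -> (s < g)%N ->
  GAut _ (adjGs n A U) =
  [set sg in GAut _ (adjGb n A) | sg @: [set x | in_alpha n A U x] == [set x | in_alpha n A U x]].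
Proof. by move=> nsA idxA _; apply: GAut_switched. Qed.
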